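(* Let $L$ be a multiplicative lattice in which $m$-distributivity holds. An element $m$ maximal in $L$, that is, a maximal element of $L\setminus\{1\}$, is a prime element of $L$ if and only if $1\cdot 1\not\leqslant m$.
   Context: A multiplicative lattice $(L,\vee,\cdot)$ is a complete lattice $L$ (least element $0$, largest element $1$) with a binary operation $\cdot\colon L\times L\to L$ such that $xy\leqslant x$ and $xy\leqslant y$ for all $x,y\in L$. $m$-distributivity holds in $L$ if $(x\vee y)z=xz\vee yz$ and $x(y\vee z)=xy\vee xz$ for all $x,y,z\in L$. An element $p\neq 1$ of $L$ is prime if, for all $x,y\in L$, $xy\leqslant p$ implies $x\leqslant p$ or $y\leqslant p$. *)

(* Defs.v *)
From HB Require Import structures.
From mathcomp Require Import all_boot all_order.
From mathcomp Require Import boolp classical_sets.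

Set Implicit Arguments.
Unset Strict Implicit.
Unset Printing Implicit Defensive.

Local Open Scope classical_set_scope.
Local Open Scope order_scope.

(* Existence of all suprema gives existence of all infima. *)
HB.mixin Record TBLattice_isComplete d T of Order.TBLattice d T := {
  exists_isLub : forall A : set T, exists s : T, isLub A s
}.

#[short(type="completeLatticeType")]
HB.structure Definition CompleteLattice d :=
  { T of Order.TBLattice d T & TBLattice_isComplete d T }.

(* No associativity, commutativity, unit or monotonicity is required of the
   multiplication, and \bot = \top is allowed. *)
HB.mixin Record CompleteLattice_isMultiplicative d T
    of CompleteLattice d T := {
  lmul : T -> T -> T;
  lmul_lel : forall x y : T, lmul x y <= x;
  lmul_ler : forall x y : T, lmul x y <= y
}.

#[short(type="multLatticeType")]
HB.structure Definition MultLattice d :=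
  { T of CompleteLattice d T & CompleteLattice_isMultiplicative d T }.

Notation "x ** y" := (lmul x y) (at level 40, left associativity)
  : order_scope.

Section MultLatticeDefs.
Context {d : Order.disp_t} {L : multLatticeType d}.

Definition prime_element (p : L) : Prop :=
  p <> \top /\ forall x y : L, x ** y <= p -> x <= p \/ y <= p.

Definition maximal_element_of (A : set L) (m : L) : Prop :=
  A m /\ forall x : L, A x -> m <= x -> x = m.

End MultLatticeDefs.

Definition m_distributive d (L : multLatticeType d) : Prop :=
  forall x y z : L,
    (x `|` y) ** z = (x ** z) `|` (y ** z) /\
    x ** (y `|` z) = (x ** y) `|` (x ** z).

(* Main.v *)
Require Import Defs.
From mathcomp Require Import all_boot all_order.
From mathcomp Require Import boolp classical_sets.
Local Open Scope order_scope.

(* If x and y are not below a maximal m, then 1 = m \/ x = m \/ y, and expanding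
   1 * 1 = (m \/ x)(m \/ y) gives a join of terms below m together with xy. *)

Import Order.TTheory.

(** Primeness tested on the pair 1, 1 excludes 1 * 1 <= m, since m is not 1. The converse rests on
    [maximal_joinx]: otherwise m \/ x would be an element other than 1 above m, hence m itself,
    forcing x <= m. *)

Lemma maximal_joinx {d : Order.disp_t} {L : multLatticeType d} {m x : L} :
  maximal_element_of (~` [set \top])%classic m -> ~ x <= m -> m `|` x = \top.
Proof.
move=> [_ mmax] xm; apply: contrapT => mx1; apply: xm.
by rewrite -(mmax _ mx1 (leUl _ _)) leUr.
Qed.

Theorem proposition3p5 (d : Order.disp_t) (L : multLatticeType d)
    (hdist : m_distributive L) (m : L)
    (hm : maximal_element_of (~` [set \top])%classic m) :
  prime_element m <-> ~ ((\top : L) ** \top <= m).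
Proof.
split=> [[m1 mP] /mP m_top|top2].
  by apply: m1; apply/eqP; rewrite -le1x; case: m_top.
split=> [|x y xy]; first by case: hm.
apply: contrapT => /not_orP[xm ym]; apply: top2.
(* The left factor 1 becomes m \/ x, the right one m \/ y. *)
rewrite -{1}(maximal_joinx hm xm) -(maximal_joinx hm ym).
(* Three terms remain to be bounded by m: m(m \/ y), which needs no further expansion, xm, and xy,
   which is [xy]. *)
rewrite (hdist _ _ _).1 (hdist x _ _).2 !leUx.
by rewrite lmul_lel lmul_ler.
Qed.
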